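(* Let $\tau\in\mathfrak H$ and let $\pi:\mathfrak H\to Y$ be the natural projection. Then the lattice $\Gamma_\tau=\mathbb{Z}+\mathbb{Z}\tau\subset\mathbb{C}=\mathbb{R}^2$ is virtually rectangular if and only if the point $\pi(\tau)\in Y$ lies on a geodesic that is closed at $\infty$.
   Context: $\mathfrak H=\{x+iy\in\mathbb{C}: y>0\}$ with the Poincaré metric $ds^2=y^{-2}(dx^2+dy^2)$; $Y=\operatorname{PSL}_2(\mathbb{Z})\backslash\mathfrak H$ (acting by Möbius transformations), whose points correspond to orientation-preserving similarity classes of lattices $\Gamma_\tau$. Geodesics on $\mathfrak H$ are vertical lines and semicircles orthogonal to the real axis; geodesics on $Y$ are images under $\pi$ of geodesics on $\mathfrak H$. A geodesic on $\mathfrak H$ is closed at $\infty$ if it is a vertical line with rational real part, or a semicircle both of whose endpoints on the real axis are rational; a geodesic on $Y$ is closed at $\infty$ if it is the image under $\pi$ of such a geodesic. A lattice is rectangular if it has an orthogonal basis, and virtually rectangular if it contains a rectangular sublattice of finite index. *)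

(* Defs.v *)
From HB Require Import structures.
From mathcomp Require Import all_boot all_order all_algebra.
From mathcomp Require Import ring.
From mathcomp Require Import generic_quotient.
From mathcomp Require Import boolp classical_sets cardinality reals.
From mathcomp Require Import complex.

Set Implicit Arguments.
Unset Strict Implicit.
Unset Printing Implicit Defensive.

Import Order.TTheory GRing.Theory Num.Theory.
Local Open Scope classical_set_scope.
Local Open Scope ring_scope.
Local Open Scope complex_scope.
Local Open Scope quotient_scope.

Section Lattices.
Variable R : realType.
Implicit Types (L : set R[i]) (u v w : R[i]).

Definition zspan u v : set R[i] :=
  [set w | exists m n : int, w = m%:~R * u + n%:~R * v].

Definition real_independent u v : Prop :=
  forall a b : R, a%:C * u + b%:C * v = 0 -> a = 0 /\ b = 0.

Definition lattice_basis L u v : Prop := real_independent u v /\ L = zspan u v.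

Definition orthogonal_vectors u v : Prop :=
  complex.Re u * complex.Re v + complex.Im u * complex.Im v = 0.

Definition rectangular L : Prop :=
  exists u v, lattice_basis L u v /\ orthogonal_vectors u v.

Definition cosets L L' : set (set R[i]) := [set [set u + v | v in L'] | u in L].

Definition virtually_rectangular L : Prop :=
  exists L', [/\ L' `<=` L, rectangular L' & finite_set (cosets L L')].

End Lattices.

Section UpperHalfPlane.
Variable R : realType.

Definition upper_half_plane : Type := {z : R[i] | 0 < complex.Im z}.
HB.instance Definition _ := Choice.on upper_half_plane.

Local Notation H := upper_half_plane.
Implicit Types z w : H.

Definition moebius (g : 'M[int]_2) (z : R[i]) : R[i] :=
  ((g 0 0)%:~R * z + (g 0 1)%:~R) / ((g 1 0)%:~R * z + (g 1 1)%:~R).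

(* The orbits of PSL_2(Z) are those of SL_2(Z), since g and - g act by the same
   Moebius transformation. *)
Definition modular_equiv z w : bool :=
  `[< exists g : 'M[int]_2, \det g = 1 /\ sval w = moebius g (sval z) >].

Lemma moebius_denom_neq0 (c d : int) z : (c != 0) || (d != 0) ->
  c%:~R * sval z + d%:~R != 0 :> R[i].
Proof.
case: z => -[x y] /= y0 cd.
have E (k : int) : k%:~R = (k%:~R : R)%:C :> R[i] by rewrite rmorph_int.
rewrite !E eq_complex /= !mul0r subr0 !addr0 mulf_eq0 (gt_eqF y0) orbF intr_eq0.
have [c0|//] := eqVneq c 0; last by rewrite andbF.
by rewrite c0 eqxx /= in cd *; rewrite mul0r add0r intr_eq0 andbT.
Qed.

Lemma det2 (g : 'M[int]_2) : \det g = g 0 0 * g 1 1 - g 0 1 * g 1 0.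
Proof.
rewrite (expand_det_row _ 0) !big_ord_recl big_ord0 /cofactor !det_mx11 !mxE /=.
have -> : lift 0 0 = 1 :> 'I_2 by exact/val_inj.
have -> : lift 1 0 = 0 :> 'I_2 by exact/val_inj.
by rewrite expr0 expr1 mul1r mulN1r mulrN addr0.
Qed.

Lemma det1_row1_neq0 (g : 'M[int]_2) : \det g = 1 -> (g 1 0 != 0) || (g 1 1 != 0).
Proof.
rewrite det2; have [->|//] := eqVneq (g 1 0) 0.
by have [->|//] := eqVneq (g 1 1) 0; rewrite !mulr0 subr0.
Qed.

Lemma modular_equiv_refl : reflexive modular_equiv.
Proof.
move=> z; apply/asboolP; exists 1%:M; split; first exact: det1.
by rewrite /moebius !mxE /= mul1r mul0r addr0 add0r divr1.
Qed.

Lemma modular_equiv_symP z w : modular_equiv z w -> modular_equiv w z.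
Proof.
move=> /asboolP[g [g1 wE]]; apply/asboolP.
exists (\matrix_(i, j) if i == 0 then (if j == 0 then g 1 1 else - g 0 1)
                       else (if j == 0 then - g 1 0 else g 0 0)).
have d0 := moebius_denom_neq0 z (det1_row1_neq0 g1).
have D : ((g 0 0)%:~R * (g 1 1)%:~R - (g 0 1)%:~R * (g 1 0)%:~R = 1 :> R[i]).
  by rewrite -!intrM -intrB -det2 g1.
split; first by rewrite det2 !mxE /= mulrNN [X in X - _]mulrC -det2.
rewrite wE /moebius !mxE /= !intrN.
set a := _%:~R in D *; set b := (g 0 1)%:~R in D *.
set c := (g 1 0)%:~R in D d0 *; set d := (g 1 1)%:~R in D d0 *.
set x := sval z in d0 *; set e := c * x + d in d0 *.
have -> : - c * ((a * x + b) / e) + a = e^-1.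
  apply: (mulIf d0); rewrite mulVf // mulrDl mulrA divfK // -D /e; ring.
have -> : d * ((a * x + b) / e) - b = x / e.
  by apply: (mulIf d0); rewrite mulrBl mulrA !divfK // -[RHS]mul1r -D /e; ring.
by rewrite invrK divfK.
Qed.

Lemma modular_equiv_sym : symmetric modular_equiv.
Proof. by move=> z w; apply/idP/idP; exact: modular_equiv_symP. Qed.

Lemma modular_equiv_trans : transitive modular_equiv.
Proof.
move=> w z t /asboolP[g [g1 wE]] /asboolP[h [h1 tE]]; apply/asboolP.
exists (h *m g); split; first by rewrite det_mulmx g1 h1 mulr1.
have d0 := moebius_denom_neq0 z (det1_row1_neq0 g1).
have e0 := moebius_denom_neq0 w (det1_row1_neq0 h1).
rewrite tE wE /moebius.
have S (i j : 'I_2) : (h *m g) i j = h i 0 * g 0 j + h i 1 * g 1 j.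
  rewrite mxE !big_ord_recl big_ord0 addr0.
  by have -> : lift 0 0 = 1 :> 'I_2 by exact/val_inj.
rewrite !S !intrD !intrM.
move: d0 e0; rewrite wE /moebius.
set n := _ + (g 0 1)%:~R; set e := _ + (g 1 1)%:~R => d0 e0.
have P (k l m f : R[i]) : f != 0 -> k * (m / f) + l = (k * m + l * f) / f.
  by move=> f0; rewrite mulrDl mulrA mulfK.
rewrite !P // invfM invrK mulrACA mulVf // mulr1 /n /e; congr (_ / _); ring.
Qed.

Canonical modular_equiv_rel :=
  EquivRel modular_equiv modular_equiv_refl modular_equiv_sym
           modular_equiv_trans.

Definition modular_surface : Type := {eq_quot modular_equiv_rel}.

Definition modular_proj (z : H) : modular_surface :=
  \pi_({eq_quot modular_equiv_rel}) z.

Definition vertical_line (c : R) : set H := [set z | complex.Re (sval z) = c].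

(* The semicircle with endpoints a and b is orthogonal to the real axis, so it
   is centred on that axis. *)
Definition semicircle (a b : R) : set H :=
  [set z | `|sval z - ((a + b) / 2)%:C| = ((b - a) / 2)%:C].

Definition closed_at_infty_H (G : set H) : Prop :=
  (exists c, rational c /\ G = vertical_line c) \/
  (exists a b, [/\ a < b, rational a, rational b & G = semicircle a b]).

Definition closed_at_infty_Y (G : set modular_surface) : Prop :=
  exists G', closed_at_infty_H G' /\ G = modular_proj @` G'.

Definition lattice_of (z : H) : set R[i] := zspan 1 (sval z).

End UpperHalfPlane.

(* Main.v *)
Require Import Defs.
From mathcomp Require Import all_boot all_order all_algebra.
From mathcomp Require Import boolp classical_sets reals.
From mathcomp Require Import ring lra zify cardinality complex.

(** The vectors [a z + b] and [c z + d] of the lattice [Z + Z z] are orthogonal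
    iff [(z + b/a) / (z + d/c)] is purely imaginary, that is, by Thales, iff [z]
    lies on the semicircle with endpoints [- b/a] and [- d/c] (a vertical line
    if [a] or [c] is zero).  If [D = a d - b c] is nonzero, they span a
    sublattice containing [D (Z + Z z)], hence of finite index.  The existence
    of such a pair only depends on the orbit of [z], because a Moebius
    transformation acts on the lattice by an integral change of basis and a
    complex rescaling, which preserves orthogonality. *)

Set Implicit Arguments.
Unset Strict Implicit.
Unset Printing Implicit Defensive.

Import Order.TTheory GRing.Theory Num.Theory.
Local Open Scope classical_set_scope.
Local Open Scope ring_scope.
Local Open Scope complex_scope.

Section Proof.
Variable R : realType.
Implicit Types (u v w : R[i]) (z : upper_half_plane R).

Lemma intrC (n : int) : n%:~R = (n%:~R : R)%:C.
Proof. by rewrite rmorph_int. Qed.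

Lemma zspan_comb u v w1 w2 (m n : int) :
  zspan u v w1 -> zspan u v w2 -> zspan u v (m%:~R * w1 + n%:~R * w2).
Proof.
move=> [a [b ->]] [c [d ->]]; exists (m * a + n * c), (m * b + n * d).
by rewrite !intrD !intrM; ring.
Qed.

(** Reducing both coordinates modulo [N] changes a vector by an element of the second span, so
    representatives with coordinates in [[0, |N|)] suffice and there are at most [N ^ 2] cosets. *)
Lemma finite_cosets u1 u2 v1 v2 (N : int) : N != 0 ->
  zspan v1 v2 (N%:~R * u1) -> zspan v1 v2 (N%:~R * u2) ->
  finite_set (cosets (zspan u1 u2) (zspan v1 v2)).
Proof.
move=> N0 Nu1 Nu2; set L := zspan v1 v2.
pose f (p : 'I_`|N| * 'I_`|N|) :=
  [set (p.1 : int)%:~R * u1 + (p.2 : int)%:~R * u2 + v | v in L].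
apply: (@sub_finite_set _ _ (range f)); last first.
  by apply: finite_image; exact: finite_finset.
have rem_lt (m : int) : (`|(m %% N)%Z| < `|N|)%N by lia.
move=> _ [_ [m [n ->]] <-].
exists (Ordinal (rem_lt m), Ordinal (rem_lt n)) => //; rewrite /f /=.
(* The remainder is nonnegative whatever the sign of [N], so the absolute value leaves it
   unchanged. *)
have remE (k : int) : k%:~R = (k %/ N)%Z%:~R * N%:~R + `|(k %% N)%Z|%N%:~R :> R[i].
  by rewrite -intrM -intrD; congr (_%:~R); lia.
set x := _ + _; set y := m%:~R * u1 + _.
have Lyx : L (y - x).
  suff -> : y - x = (m %/ N)%Z%:~R * (N%:~R * u1) + (n %/ N)%Z%:~R * (N%:~R * u2).
    exact: zspan_comb.
  by rewrite /y /x (remE m) (remE n); ring.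
apply/seteqP; split=> _ [v Lv <-].
- exists (v - (y - x)); last by ring.
  by have := zspan_comb 1 (-1) Lv Lyx; rewrite mulr1z mul1r mulN1r.
- exists (v + (y - x)); last by ring.
  by have := zspan_comb 1 1 Lv Lyx; rewrite mulr1z !mul1r.
Qed.

Lemma orthogonal_vectors_sym u v : orthogonal_vectors u v -> orthogonal_vectors v u.
Proof. by rewrite /orthogonal_vectors => <-; ring. Qed.

(** Multiplication by [w] is a similarity: it multiplies the inner product by [|w| ^ 2]. *)
Lemma orthogonal_vectorsMl w u v :
  orthogonal_vectors u v -> orthogonal_vectors (w * u) (w * v).
Proof.
rewrite /orthogonal_vectors; case: u v w => [a b] [c d] [e f] /= uv.
by transitivity ((e ^+ 2 + f ^+ 2) * (a * c + b * d)); [ring|rewrite uv mulr0].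
Qed.

Lemma orthogonal_vectors_scale (r s : R) u v :
  orthogonal_vectors u v -> orthogonal_vectors (r%:C * u) (s%:C * v).
Proof.
rewrite /orthogonal_vectors; case: u v => [a b] [c d] /= uv.
by transitivity (r * s * (a * c + b * d)); [ring|rewrite uv mulr0].
Qed.

Definition has_orthogonal_pair w : Prop :=
  exists a b c d : int, a * d - b * c != 0 /\
    orthogonal_vectors (a%:~R * w + b%:~R) (c%:~R * w + d%:~R).

(** As [Im z > 0], the numbers [z] and [1] are independent over the reals, so independence of the
    two vectors is that of the rows of their coefficient matrix. *)
Lemma real_independent_lattice z (a b c d : int) :
  real_independent (a%:~R * sval z + b%:~R) (c%:~R * sval z + d%:~R) <->
  a * d - b * c != 0.
Proof.
case: z => -[x y] /= y0; rewrite !intrC; split.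
- move=> indep; apply/eqP => /eqP; rewrite subr_eq0 => /eqP adbc.
  have adbcR : a%:~R * d%:~R = b%:~R * c%:~R :> R by rewrite -!intrM adbc.
  (* If [a d = b c], then [c (a z + b) - a (c z + d) = 0], which forces [a = c = 0]. The real
     numbers [b] and [d] that remain are dependent, so they vanish too, and then any relation
     holds. *)
  have [] := indep c%:~R (- a%:~R).
    by apply/eqP; rewrite eq_complex /=; apply/andP; split; apply/eqP; ring: adbcR.
  move=> c0 /eqP; rewrite oppr_eq0 => /eqP a0.
  have [] := indep d%:~R (- b%:~R).
    by apply/eqP; rewrite eq_complex /= a0 c0; apply/andP; split; apply/eqP; ring.
  move=> d0 /eqP; rewrite oppr_eq0 => /eqP b0.
  have [] := indep 1 0.
    by apply/eqP; rewrite eq_complex /= a0 b0; apply/andP; split; apply/eqP; ring.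
  by move/eqP; rewrite oner_eq0.
- move=> D0 r s /eqP; rewrite eq_complex /= => /andP[/eqP re /eqP im].
  have DR0 : a%:~R * d%:~R - b%:~R * c%:~R != 0 :> R by rewrite -!intrM -intrB intr_eq0.
  have im0 : r * a%:~R + s * c%:~R = 0.
    by apply: (mulIf (lt0r_neq0 y0)); rewrite mul0r -im; ring.
  have re0 : r * b%:~R + s * d%:~R = 0.
    rewrite -re; transitivity (r * b%:~R + s * d%:~R + (r * a%:~R + s * c%:~R) * x); last by ring.
    by rewrite im0; ring.
  (* Cramer's rule for the system [im0], [re0]. *)
  split; apply: (mulIf DR0); rewrite mul0r.
  - transitivity ((r * a%:~R + s * c%:~R) * d%:~R - (r * b%:~R + s * d%:~R) * c%:~R); first by ring.
    by rewrite im0 re0; ring.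
  - transitivity ((r * b%:~R + s * d%:~R) * a%:~R - (r * a%:~R + s * c%:~R) * b%:~R); first by ring.
    by rewrite im0 re0; ring.
Qed.

Lemma virtually_rectangularP z :
  virtually_rectangular (lattice_of z) <-> has_orthogonal_pair (sval z).
Proof.
split.
- move=> [L' [sub [u [v [[indep L'E] orth]]] _]].
  have Lu : lattice_of z u by apply: sub; rewrite L'E; exists 1, 0; ring.
  have Lv : lattice_of z v by apply: sub; rewrite L'E; exists 0, 1; ring.
  (* In [zspan 1 z] the coefficient of [1] comes first, hence [b] before [a] and [d] before [c]. *)
  case: Lu Lv => [b [a uE]] [d [c vE]].
  rewrite mulr1 addrC in uE; rewrite mulr1 addrC in vE.
  by exists a, b, c, d; rewrite -uE -vE; split=> //;
    apply/(@real_independent_lattice z); rewrite -uE -vE.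
- move=> [a [b [c [d [D0 orth]]]]].
  set u := a%:~R * _ + _ in orth; set v := c%:~R * _ + _ in orth.
  exists (zspan u v); split.
  + move=> _ [m [n ->]]; exists (m * b + n * d), (m * a + n * c).
    by rewrite /u /v !intrD !intrM; ring.
  + by exists u, v; split=> //; split=> //; apply/real_independent_lattice.
  (* The adjugate matrix gives the witnesses: with [D = a d - b c], [D = - c u + a v] and
     [D z = d u - b v]. *)
  + apply: (finite_cosets D0).
    * by exists (- c), a; rewrite /u /v intrB !intrM intrN; ring.
    * by exists d, (- b); rewrite /u /v intrB !intrM intrN; ring.
Qed.

Lemma has_orthogonal_pair_modular (z w : upper_half_plane R) :
  modular_equiv z w -> has_orthogonal_pair (sval w) -> has_orthogonal_pair (sval z).
Proof.
move=> /asboolP[g [g1 wE]] [a [b [c [d [D0 orth]]]]].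
have e0 := moebius_denom_neq0 z (det1_row1_neq0 g1).
(* These are the entries of the product of the matrix with rows [(a, b)], [(c, d)] by [g]. Its
   vectors at [z] are those at [w] times the denominator of [moebius g]. *)
exists (a * g 0 0 + b * g 1 0), (a * g 0 1 + b * g 1 1),
  (c * g 0 0 + d * g 1 0), (c * g 0 1 + d * g 1 1); split.
  suff -> : forall p q r s : int,
      (a * p + b * r) * (c * q + d * s) - (a * q + b * s) * (c * p + d * r) =
      (a * d - b * c) * (p * s - q * r) by rewrite -det2 g1 mulr1.
  by move=> p q r s; ring.
have := orthogonal_vectorsMl ((g 1 0)%:~R * sval z + (g 1 1)%:~R) orth.
rewrite wE /moebius.
have E (p q n e : R[i]) : e != 0 -> e * (p * (n / e) + q) = p * n + q * e.
  by move=> ?; field.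
rewrite !E // !intrD !intrM; congr orthogonal_vectors; ring.
Qed.

Lemma rationalP (r : R) :
  rational r <-> exists p q : int, q != 0 /\ r = p%:~R / q%:~R.
Proof.
split=> [[x _ <-]|[p [q [q0 ->]]]].
- by exists (numq x), (denq x); rewrite denq_neq0.
- by exists (p%:~R / q%:~R) => //; rewrite fmorph_div /= !ratr_int.
Qed.

Lemma semicircleP (r s : R) z : r < s ->
  semicircle r s z <-> orthogonal_vectors (sval z - r%:C) (sval z - s%:C).
Proof.
case: z => -[x y] y0 rs; rewrite /semicircle /orthogonal_vectors /=.
rewrite normc_def /=.
have rad0 : 0 <= (s - r) / 2 by lra.
(* Thales in quantitative form: the squared distance to the centre is the squared radius plus the
   inner product of [z - r] and [z - s]. *)
have E : (x - (r + s) / 2) ^+ 2 + (y - 0) ^+ 2 =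
    ((s - r) / 2) ^+ 2 + ((x - r) * (x - s) + (y - 0) * (y - 0)) by field.
rewrite E; split.
- move=> [] sqrtE; have := congr1 (fun t => t ^+ 2) sqrtE.
  rewrite sqr_sqrtr; last by rewrite -E addr_ge0 ?sqr_ge0.
  lra.
- by move=> ->; rewrite addr0 sqrtr_sqr ger0_norm.
Qed.

Lemma vertical_lineP (r : R) z :
  vertical_line r z <-> orthogonal_vectors (sval z - r%:C) 1.
Proof.
case: z => -[x y] y0; rewrite /vertical_line /orthogonal_vectors /=.
by split=> ?; lra.
Qed.

Lemma intr_frac_scale w (p q : int) : q != 0 ->
  (q%:~R : R)%:C * (w - (p%:~R / q%:~R : R)%:C) = q%:~R * w + (- p)%:~R.
Proof.
move=> q0; have qR0 : q%:~R != 0 :> R by rewrite intr_eq0.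
rewrite mulrBr -rmorphM /= mulrC -[in RHS]mulrC intrN !intrC.
by congr (_ - _%:C); field.
Qed.

Lemma has_orthogonal_pairP z :
  has_orthogonal_pair (sval z) <->
  exists G, closed_at_infty_H G /\ G z.
Proof.
split; last first.
  case=> G [[[r [/rationalP[p [q [q0 rE]]] ->]]|]].
    (* A vertical line has its second endpoint at infinity, which corresponds to the lattice vector
       [1]. *)
    move=> /vertical_lineP orth; exists q, (- p), 0, 1; split.
      by rewrite mulr1 mulr0 subr0.
    have := orthogonal_vectors_scale q%:~R 1 orth.
    by rewrite rE intr_frac_scale // mul0r add0r mulr1.
  move=> [r [s [rs /rationalP[p [q [q0 rE]]] /rationalP[p' [q' [q'0 sE]]] ->]]].
  move=> /(semicircleP _ rs) orth; exists q, (- p), q', (- p'); split.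
    (* A zero determinant would make the two endpoints equal. *)
    apply: contraTneq rs => D0; rewrite rE sE.
    suff -> : p%:~R / q%:~R = p'%:~R / q'%:~R :> R by rewrite ltxx.
    apply/eqP; rewrite eqr_div ?intr_eq0 // -!intrM eqr_int; apply/eqP; lia.
  have := orthogonal_vectors_scale q%:~R q'%:~R orth.
  by rewrite rE sE !intr_frac_scale.
have fracE (a b : int) : a != 0 ->
    (a%:~R^-1)%:C * (a%:~R * sval z + b%:~R) = sval z - ((- b)%:~R / a%:~R : R)%:C.
  move=> a0; have aR0 : a%:~R != 0 :> R by rewrite intr_eq0.
  rewrite !intrC mulrDr mulrA -!rmorphM /= mulVf // mul1r; congr (_ + _).
  by rewrite -rmorphN /=; congr (_%:C); rewrite intrN; field.
have frac_rational (a b : int) : a != 0 -> rational ((- b)%:~R / a%:~R : R).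
  by move=> a0; apply/rationalP; exists (- b), a.
have line (a b d : int) : a != 0 -> d != 0 ->
    orthogonal_vectors (a%:~R * sval z + b%:~R) (0%:~R * sval z + d%:~R) ->
    exists G, closed_at_infty_H G /\ G z.
  move=> a0 d0 /(orthogonal_vectors_scale a%:~R^-1 d%:~R^-1).
  rewrite fracE // mul0r add0r intrC -rmorphM /= mulVf ?intr_eq0 // => orth.
  exists (vertical_line ((- b)%:~R / a%:~R)); split; last exact/vertical_lineP.
  by left; exists ((- b)%:~R / a%:~R); split=> //; exact: frac_rational.
have circle (a b c d : int) : a != 0 -> c != 0 ->
    (- b)%:~R / a%:~R < (- d)%:~R / c%:~R :> R ->
    orthogonal_vectors (a%:~R * sval z + b%:~R) (c%:~R * sval z + d%:~R) ->
    exists G, closed_at_infty_H G /\ G z.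
  move=> a0 c0 lt /(orthogonal_vectors_scale a%:~R^-1 c%:~R^-1).
  rewrite !fracE // => orth.
  exists (semicircle ((- b)%:~R / a%:~R) ((- d)%:~R / c%:~R)).
  split; last exact/semicircleP.
  by right; do 2!eexists; split; [exact: lt|exact: frac_rational|exact: frac_rational|].
move=> [a [b [c [d [D0 orth]]]]].
have [a0|a0] := eqVneq a 0.
  subst a; apply: (line c d b); [lia|lia|exact: orthogonal_vectors_sym].
have [c0|c0] := eqVneq c 0.
  subst c; apply: (line a b d) => //; lia.
(* A semicircle takes its endpoints in increasing order, so the vectors may have to be swapped;
   equal endpoints contradict [D0]. *)
case: (ltgtP ((- b)%:~R / a%:~R : R) ((- d)%:~R / c%:~R)) => [lt|lt|/eqP].
- exact: (circle a b c d).
- by apply: (circle c d a b) => //; exact: orthogonal_vectors_sym.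
- rewrite eqr_div ?intr_eq0 // -!intrM eqr_int => /eqP; lia.
Qed.

End Proof.

Theorem theorem5p1 (R : realType) (tau : upper_half_plane R) :
  virtually_rectangular (lattice_of tau) <->
  exists G : set (modular_surface R),
    closed_at_infty_Y G /\ G (modular_proj tau).
Proof.
split.
- move=> /virtually_rectangularP /has_orthogonal_pairP [G [closedG Gtau]].
  by exists ((@modular_proj R) @` G)%classic; split; [exists G | exists tau].
(* The lifted geodesic need only meet the orbit of [tau], at [z], so the orthogonal pair found at
   [z] is carried over to [tau]. *)
- move=> [_ [[G [closedG ->]] [z Gz /eqmodP eqv]]].
  apply/virtually_rectangularP/(has_orthogonal_pair_modular (w := z)).
    exact: modular_equiv_symP.
  by apply/has_orthogonal_pairP; exists G.
Qed.
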